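(* Let $D>1$ be fixed, $0<\lambda<\lambda_D$, and assume $\Gamma$ is a complete $D$-ary tree of depth $h$ with \[ h\le \underline h-\frac{\ln(\underline h)}{\ln(D)}+\frac{\ln(1-\frac1D)}{\ln(D)}. \] Then the total variation distance between $\mathbb{P}_1$ and $\mathbb{P}_0$ tends to $0$ as $n\to\infty$. Thus for any test $T(G)\in\{0,1\}$, $\mathbb{P}_1(T(G)=1)-\mathbb{P}_0(T(G)=1)\to0$.
   Context: Model: $\mathbb{P}_0$: $G\sim\mathcal G(n,\lambda/n)$; $\mathbb{P}_1$: $G=G_0\cup G'$ with $G_0\sim\mathcal G(n,\lambda/n)$ and $G'$ the image of $\Gamma$ under a uniformly random injection of its vertex set into $[n]$, independent of $G_0$. A complete $D$-ary tree of depth $h$ has root at depth $0$, each vertex at depth $<h$ has $D$ children, and $K=(D^{h+1}-1)/(D-1)$ vertices. $\psi_D(\mu)=\mathbb{P}(\mathrm{Poi}(\mu)\ge D)$; $p_*(D,\lambda)$ is the largest nonnegative root of $p=\psi_D(\lambda p)$; $\lambda_D=\sup\{\lambda>0:p_*(D,\lambda)=0\}$. $p_h$ is the probability that a Galton–Watson tree with offspring $\mathrm{Poi}(\lambda)$ contains a complete $D$-ary tree of depth $h$ rooted at its root, and $\underline h=\sup\{h>0:p_h>\ln(n)/n\}$. *)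

(* Defs.v *)
From HB Require Import structures.
From mathcomp Require Import all_boot all_order all_algebra.
From mathcomp Require Import all_classical all_reals all_analysis.
Set Implicit Arguments. Unset Strict Implicit. Unset Printing Implicit Defensive.
Import Order.TTheory GRing.Theory Num.Theory.
Import numFieldNormedType.Exports.
Local Open Scope ring_scope.

Definition poisson_pmf (R : realType) (mu : R) (k : nat) : R :=
  expR (- mu) * mu ^+ k / (k`!)%:R.

Definition psi (R : realType) (D : nat) (mu : R) : R :=
  1 - \sum_(k < D) poisson_pmf mu k.

Definition binom_tail (R : realType) (q : R) (k D : nat) : R :=
  \sum_(D <= j < k.+1) ('C(k, j))%:R * q ^+ j * (1 - q) ^+ (k - j).

(* Branching step: the root of a Poi(lam) Galton-Watson tree has k children with
   probability poisson_pmf lam k; given k, each child subtree independently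
   contains the depth-h pattern with probability q; the root contains the
   depth-(h+1) pattern iff at least D children do. *)
Definition gw_step (R : realType) (lam : R) (D : nat) (q : R) : R :=
  limn (series (fun k : nat => poisson_pmf lam k * binom_tail q k D)).

(* p_h : probability that a Poi(lam) Galton-Watson tree contains a complete
   D-ary tree of depth h rooted at its root. *)
Fixpoint ph (R : realType) (lam : R) (D : nat) (h : nat) : R :=
  match h with
  | 0 => 1
  | h'.+1 => gw_step lam D (ph lam D h')
  end.

Definition p_star (R : realType) (D : nat) (lam : R) : R :=
  sup [set p : R | 0 <= p /\ p = psi D (lam * p)]%classic.

Definition lambda_D (R : realType) (D : nat) : R :=
  sup [set l : R | 0 < l /\ p_star D l = 0]%classic.

Definition underline_h (R : realType) (lam : R) (D n : nat) : R :=
  sup [set x : R | exists h : nat,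
         (0 < h)%N /\ x = h%:R /\ ln (n%:R) / n%:R < ph lam D h]%classic.

(* A (simple) graph on [n] is a set of ordered pairs (i, j) with i < j. *)
Definition graph (n : nat) := {set 'I_n * 'I_n}.

Definition slots (n : nat) : graph n := [set e | (val e.1 < val e.2)%N].

Definition P0 (R : realType) (n : nat) (p : R) (G : graph n) : R :=
  if G \subset slots n then p ^+ #|G| * (1 - p) ^+ (#|slots n| - #|G|) else 0.

Definition nedge (n : nat) (a b : 'I_n) : 'I_n * 'I_n :=
  if (val a < val b)%N then (a, b) else (b, a).

(* Complete D-ary tree of depth h, K = (D^(h+1) - 1)/(D - 1) vertices,
   labelled 0..K-1 in breadth-first order: the parent of v >= 1 is (v-1)/D. *)
Definition tree_size (D h : nat) : nat := (D ^ h.+1 - 1) %/ (D - 1).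

Definition tree_edges (D h : nat) : {set 'I_(tree_size D h) * 'I_(tree_size D h)} :=
  [set e | (0 < val e.2)%N && (val e.1 == (val e.2 - 1) %/ D)%N].

Definition planted (n D h : nat) (sigma : {ffun 'I_(tree_size D h) -> 'I_n}) : graph n :=
  [set nedge (sigma e.1) (sigma e.2) | e in tree_edges D h].

Definition injections (n D h : nat) : {set {ffun 'I_(tree_size D h) -> 'I_n}} :=
  [set sigma : {ffun 'I_(tree_size D h) -> 'I_n} | injectiveb sigma].

Definition P1 (R : realType) (n : nat) (p : R) (D h : nat) (G : graph n) : R :=
  (#|injections n D h|%:R)^-1 *
  \sum_(sigma in injections n D h)
     \sum_(G0 : graph n) P0 p G0 * (G == G0 :|: planted sigma)%:R.

Definition tv (R : realType) (n : nat) (p : R) (D h : nat) : R :=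
  2^-1 * \sum_(G : graph n) `|P1 p D h G - P0 p G|.

Definition prob_test (R : realType) (n : nat) (P : graph n -> R)
  (T : graph n -> bool) : R :=
  \sum_(G : graph n) P G * (T G)%:R.

(* Main.v *)
(** Second moment method. The likelihood ratio L = dP1/dP0 satisfies
    E_0 [L^2] = E [p^(-|A :&: A'|)] for two independent random copies A, A' of
    the tree, and TV is controlled by E_0 [L^2] - 1. Fix A' and expand
    p^(-|A :&: A'|) over sub-forests F of the tree. A map of the tree sending
    the edges of F into A' is chosen vertex by vertex in breadth-first order:
    at most D + 1 choices for a vertex joined to its parent by an edge of F, at
    most K for the root of a nontrivial component of F, at most n otherwise.
    A nonempty F has such a root, so its contribution is at most C^K K / n and
    E_0 [L^2] - 1 <= (8 C)^K / n. It thus suffices that K = o(ln n).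

    By Poisson thinning p_(h+1) = psi_D (lam p_h). For lam < lambda_D the map
    p |-> psi_D (lam p) lies strictly below the identity on p > 0, so p_h tends
    to 0, and psi_D (mu) <= mu^D makes the decay doubly exponential:
    p_h <= exp (- D^(h - h0)). Hence D^(underline h) = O(ln n), while
    underline h tends to infinity because every p_h is positive; the hypothesis
    then gives D^h <= D^(underline h) / underline h = o(ln n). *)
Require Import Defs.
From HB Require Import structures.
From mathcomp Require Import all_boot all_order all_algebra.
From mathcomp Require Import all_classical all_reals all_analysis.
From mathcomp Require Import ring lra zify.
Import Order.TTheory GRing.Theory Num.Theory.
Import numFieldNormedType.Exports.
Local Open Scope classical_set_scope.
Local Open Scope ring_scope.
Set Implicit Arguments.
Unset Strict Implicit.
Unset Printing Implicit Defensive.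

(* MathComp-Analysis has a [poisson_pmf] of its own, which shadows the one of [Defs]. *)
Local Notation poisson_pmf := Defs.poisson_pmf.

(** * Poisson tails *)

Section PoissonTail.
Variable R : realType.
Implicit Types (mu x y : R) (D k : nat).

Lemma poisson_pmf_gt0 mu k : 0 < mu -> 0 < poisson_pmf mu k.
Proof. by move=> mu0; rewrite /Defs.poisson_pmf !mulr_gt0 ?expR_gt0 ?exprn_gt0 ?invr_gt0
  ?ltr0n ?fact_gt0. Qed.

Lemma poisson_pmf0 mu : poisson_pmf mu 0 = expR (- mu).
Proof. by rewrite /Defs.poisson_pmf expr0 mulr1 fact0 divr1. Qed.

Lemma psi_recr D mu : psi D.+1 mu = psi D mu - poisson_pmf mu D.
Proof. by rewrite /psi big_ord_recr /= opprD addrA. Qed.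

Lemma psi0 D : psi D.+1 (0 : R) = 0.
Proof.
elim: D => [|D IH]; first by rewrite /psi big_ord1 poisson_pmf0 oppr0 expR0 subrr.
by rewrite psi_recr IH /Defs.poisson_pmf expr0n/= mulr0 mul0r subr0.
Qed.

Lemma is_derive_poisson_pmf0 mu :
  is_derive mu 1 (fun x => poisson_pmf x 0) (- poisson_pmf mu 0).
Proof.
under eq_fun do rewrite poisson_pmf0.
by apply: is_derive_eq; rewrite poisson_pmf0 mulrN1.
Qed.

Lemma is_derive_poisson_pmfS mu k :
  is_derive mu 1 (fun x => poisson_pmf x k.+1) (poisson_pmf mu k - poisson_pmf mu k.+1).
Proof.
have -> : (fun x => poisson_pmf x k.+1) =
    ((k.+1)`!%:R^-1) \*: ((expR \o -%R) * (@GRing.exp (R -> R) id k.+1)).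
  by apply/funext => x; rewrite /Defs.poisson_pmf /GRing.scale /= !fctE /GRing.scale /= mulrC.
apply: is_derive_eq.
rewrite /Defs.poisson_pmf factS natrM /GRing.scale /=.
have k0 : (k`!)%:R != 0 :> R by rewrite pnatr_eq0 -lt0n fact_gt0.
rewrite !fctE exprS; field.
by rewrite k0 -[X in X + _]/(1%:R) -natrD pnatr_eq0.
Qed.

(** Telescoping: the mass at k + 1 has derivative mass k minus mass k + 1, so only the last mass
    survives. *)
Lemma is_derive_psi mu D : is_derive mu 1 (psi D.+1) (poisson_pmf mu D).
Proof.
elim: D => [|D IH].
  have -> : psi 1 = cst 1 - (fun x : R => poisson_pmf x 0).
    by apply/funext => x; rewrite /psi big_ord1.
  apply: is_derive_eq (is_deriveB (is_derive_cst _ _ _) (is_derive_poisson_pmf0 mu)) _.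
  by rewrite sub0r opprK.
have -> : psi D.+2 = psi D.+1 - (fun x : R => poisson_pmf x D.+1).
  by apply/funext => x; rewrite psi_recr.
apply: is_derive_eq (is_deriveB IH (is_derive_poisson_pmfS mu D)) _.
by rewrite opprB addrCA subrr addr0.
Qed.

Lemma continuous_psi D : continuous (psi D.+1 : R -> R).
Proof.
by move=> x; apply/differentiable_continuous/derivable1_diffP; have [] := is_derive_psi x D.
Qed.

Lemma psi_lt D x y : 0 <= x -> x < y -> psi D.+1 x < psi D.+1 y.
Proof.
move=> x0 xy.
apply: (@gtr0_derive1_incr R (psi D.+1) 0 y) => // [z _|z|].
- by have [] := is_derive_psi z D.
- by rewrite in_itv/= => /andP[z0 _]; rewrite derive1E (@derive_val _ _ _ _ _ _ _
  (is_derive_psi z D)) poisson_pmf_gt0.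
- exact/continuous_subspaceT/continuous_psi.
Qed.

Lemma psi_le D x y : 0 <= x -> x <= y -> psi D.+1 x <= psi D.+1 y.
Proof. by move=> x0; rewrite le_eqVlt => /orP[/eqP->//|/(psi_lt D x0)/ltW]. Qed.

Lemma psi_gt0 D x : 0 < x -> 0 < psi D.+1 x.
Proof. by move=> x0; rewrite -(psi0 D) psi_lt. Qed.

Lemma psi_lt1 D x : 0 <= x -> psi D.+1 x < 1.
Proof.
move=> x0; rewrite /psi ltrBlDr ltrDl big_ord_recl/= poisson_pmf0.
rewrite ltr_pwDl ?expR_gt0 ?sumr_ge0// => i _.
by rewrite /Defs.poisson_pmf !mulr_ge0 ?expR_ge0 ?exprn_ge0.
Qed.

(** Both sides vanish at 0, and the derivatives compare: z^D e^(-z) / D! <= (D + 1) z^D. *)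
Lemma psi_le_expr D x : 0 <= x -> psi D.+1 x <= x ^+ D.+1.
Proof.
move=> x0; rewrite -subr_ge0.
pose f (z : R) := z ^+ D.+1 - psi D.+1 z.
have df (z : R) : is_derive z 1 f (D.+1%:R * z ^+ D - poisson_pmf z D).
  have -> : f = (@GRing.exp (R -> R) id D.+1) - psi D.+1 by apply/funext => y; rewrite !fctE.
  apply: is_derive_eq (is_deriveB _ (is_derive_psi z D)) _.
  by rewrite /GRing.scale/= mulr1.
have -> : 0 = f 0 by rewrite /f psi0 expr0n subr0.
apply: (@ger0_derive1_ndecr R f 0 x) => // [z|].
- rewrite in_itv/= => /andP[z0 _]; rewrite derive1E derive_val subr_ge0.
  rewrite /Defs.poisson_pmf mulrAC ler_pM2r ?exprn_gt0//.
  rewrite (@le_trans _ _ 1) ?ler1n//.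
  rewrite ler_pdivrMr ?ltr0n ?fact_gt0// mul1r (@le_trans _ _ 1)//.
    by rewrite expR_le1 oppr_le0 ltW.
  by rewrite ler1n fact_gt0.
- apply: continuous_subspaceT => z.
  by apply/differentiable_continuous/derivable1_diffP; have [] := df z.
Qed.

End PoissonTail.

(** * Poisson thinning of the branching step *)

Section Thinning.
Variable R : realType.
Implicit Types (lam q : R) (D : nat).

(** Complement in the binomial theorem. If D > k + 1 the tail is empty and the extra coefficients on
    the right vanish. *)
Lemma binom_tailE q k D :
  binom_tail q k D = 1 - \sum_(j < D) ('C(k, j))%:R * q ^+ j * (1 - q) ^+ (k - j).
Proof.
have E : \sum_(j < k.+1) ('C(k, j))%:R * q ^+ j * (1 - q) ^+ (k - j) = 1.
  have := exprDn (1 - q) q k; rewrite subrK expr1n => E; rewrite [RHS]E.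
  by apply: eq_bigr => i _; rewrite -[RHS]mulr_natl mulrCA mulrC mulrA.
pose F j := ('C(k, j))%:R * q ^+ j * (1 - q) ^+ (k - j).
rewrite -(big_mkord xpredT F) in E; rewrite -(big_mkord xpredT F) /binom_tail.
have [Dk|kD] := leqP D k.+1.
  by rewrite (big_cat_nat (n := D))//= in E; apply/esym/eqP; rewrite subr_eq addrC E.
rewrite [LHS]big_geq; last exact: ltnW.
rewrite (@big_cat_nat _ _ _ k.+1) ?(ltnW kD)//= E big_nat_cond big1.
  by rewrite addr0 subrr.
by move=> j /andP[/andP[kj _] _]; rewrite /F bin_small// !mul0r.
Qed.

Lemma cvg_series_poisson lam : series (poisson_pmf lam) @ \oo --> (1 : R).
Proof.
have -> : poisson_pmf lam = expR (- lam) *: exp_coeff lam.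
  by apply/funext => k; rewrite /Defs.poisson_pmf /exp_coeff /= -mulrA.
rewrite seriesZ -(mulVf (lt0r_neq0 (expR_gt0 lam))) -expRN.
by apply: cvgZl_tmp; exact: is_cvg_series_exp_coeff.
Qed.

(** Terms with k < j vanish; for k = j + i the term is the mass of Poi(lam q) at j times the mass of
    Poi(lam (1 - q)) at i, and the latter masses sum to 1. *)
Lemma cvg_series_thinned lam q j :
  series (fun k => poisson_pmf lam k * (('C(k, j))%:R * q ^+ j * (1 - q) ^+ (k - j)))
    @ \oo --> poisson_pmf (lam * q) j.
Proof.
rewrite -(cvg_shiftn j).
set u := (X in X @ \oo --> _).
have -> : u = poisson_pmf (lam * q) j * expR (- (lam * (1 - q))) *: series (exp_coeff (lam *
  (1 - q))).
  apply/funext => m; rewrite /u /series /= addnC.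
  rewrite (big_cat_nat (n := j)) ?leq_addr//= big_nat_cond big1 ?add0r; last first.
    by move=> k /andP[/andP[_ kj] _]; rewrite bin_small// !mul0r mulr0.
  rewrite -{1}[j]add0n big_addn addKn !fctE /GRing.scale /= mulr_sumr.
  apply: eq_bigr => k _; rewrite addnK /Defs.poisson_pmf /exp_coeff /=.
  have -> : expR (- lam) = expR (- (lam * q)) * expR (- (lam * (1 - q))).
    by rewrite -expRD; congr expR; ring.
  have -> : ('C(k + j, j))%:R = ((k + j)`!)%:R / ((j`!)%:R * (k`!)%:R) :> R.
    rewrite -natrM; apply: (canRL (mulfK _)); first by rewrite pnatr_eq0 muln_eq0 negb_or
      -!lt0n !fact_gt0.
    by rewrite -natrM -[in RHS](bin_fact (leq_addl k j)) addnK.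
  have nz i : (i`!)%:R != 0 :> R by rewrite pnatr_eq0 -lt0n fact_gt0.
  by rewrite exprD !exprMn; field; rewrite !nz.
have {2}-> : poisson_pmf (lam * q) j =
    poisson_pmf (lam * q) j * expR (- (lam * (1 - q))) * expR (lam * (1 - q)).
  by rewrite -mulrA -expRD addNr expR0 mulr1.
by apply: cvgZl_tmp; exact: is_cvg_series_exp_coeff.
Qed.

Lemma gw_stepE lam q D : gw_step lam D q = psi D (lam * q).
Proof.
rewrite /gw_step; apply/cvg_lim => //.
(* The complement of the tail is a sum over the fixed range j < D, so the limit can be taken term by
   term. *)
have -> : series (fun k => poisson_pmf lam k * binom_tail q k D) =
   (fun n => series (poisson_pmf lam) n - \sum_(j < D) series (fun k => poisson_pmf lam k *
     (('C(k, j))%:R * q ^+ j * (1 - q) ^+ (k - j))) n).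
  apply/funext => n; rewrite /series /= exchange_big /= -sumrB.
  by apply: eq_bigr => k _; rewrite binom_tailE mulrBr mulr1 big_distrr.
rewrite /psi; apply: cvgB; first exact: cvg_series_poisson.
have := @cvg_big R _ _ 0 xpredT (@add_continuous R) _ \oo (index_enum 'I_D) _ _ _
  (fun (j : 'I_D) _ => @cvg_series_thinned lam q j).
exact.
Qed.

Lemma phS lam D h : ph lam D h.+1 = psi D (lam * ph lam D h).
Proof. exact: gw_stepE. Qed.

End Thinning.

(** * The subcritical regime *)

Section Subcritical.
Variables (R : realType) (D' : nat) (lam : R).
Local Notation D := D'.+1.
Hypotheses (lam_gt0 : 0 < lam) (lam_lt : lam < lambda_D R D).

(** Some l > lam has [p_star] equal to 0. If psi (l p) >= p, then psi (l x) - x changes sign on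
    [p, 1], and its zero is a positive fixed point at l, a contradiction. *)
Lemma psi_lt_id (p : R) : 0 < p -> psi D (lam * p) < p.
Proof.
move=> p0.
(* [sup] is 0 on a set without supremum, which 0 < lam < [lambda_D] excludes. *)
have supS : has_sup [set l : R | 0 < l /\ p_star D l = 0].
  apply: contrapT => /sup_out S0; move: lam_lt; rewrite /lambda_D S0.
  by rewrite ltNge (ltW lam_gt0).
have [|l [l0 pl0]] := sup_adherent _ supS (eps := lambda_D R D - lam).
  by rewrite subr_gt0.
rewrite -/(lambda_D R D) subKr => lam_l.
apply: (@le_lt_trans _ _ (psi D (l * p))).
  by rewrite psi_le ?mulr_ge0 ?(ltW lam_gt0) ?(ltW p0)// ler_pM2r// ltW.
rewrite ltNge; apply/negP => le_p.
have p1 : p <= 1 by rewrite (le_trans le_p)// ltW// psi_lt1// mulr_ge0 ?ltW.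
have [||c] := @IVT R (fun x => psi D (l * x) - x) p 1 0 p1.
- apply: continuous_subspaceT => x; apply: cvgB => //.
  apply: (@cvg_comp _ _ _ ( *%R l) (psi D) _ (nbhs (l * x))) => //.
    by apply: cvgMl_tmp; exact: cvg_id.
  exact: continuous_psi.
- rewrite /= ge_min le_max !subr_ge0 !subr_le0 le_p mulr1 (ltW (psi_lt1 _ (ltW l0))).
  by rewrite orbT.
rewrite in_itv/= => /andP[pc c1] /eqP; rewrite subr_eq0 => /eqP cE.
have c0 : 0 < c := lt_le_trans p0 pc.
(* Fixed points are bounded by 1, so their supremum is a genuine upper bound. *)
have : c <= p_star D l.
  apply: sup_upper_bound; last by split => //; exact: ltW.
  split; first by exists c; split => //; exact: ltW.
  exists 1 => x [x0 ->]; by rewrite ltW// psi_lt1// mulr_ge0// ltW.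
by rewrite pl0 leNgt c0.
Qed.

Lemma ph_gt0 k : 0 < ph lam D k.
Proof. by elim: k => [|k IH]; rewrite ?ltr01// phS psi_gt0// mulr_gt0. Qed.

Lemma ph_nonincreasing : nonincreasing_seq (ph lam D).
Proof.
by apply/nonincreasing_seqP => k; rewrite phS ltW// psi_lt_id// ph_gt0.
Qed.

(** A nonincreasing positive sequence converges; by continuity its limit is a fixed point, and
    [psi_lt_id] leaves only 0. *)
Lemma cvg_ph : ph lam D @ \oo --> (0 : R).
Proof.
have cvg : cvgn (ph lam D).
  apply: nonincreasing_is_cvgn; first exact: ph_nonincreasing.
  by exists 0 => _ [k _ <-]; rewrite ltW// ph_gt0.
suff l0 : limn (ph lam D) = 0 by rewrite -l0.
set l := limn _.
have lge0 : 0 <= l by apply: limr_ge => //; apply: nearW => k; rewrite ltW// ph_gt0.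
have : psi D (lam * ph lam D k) @[k --> \oo] --> psi D (lam * l).
  apply: (@cvg_comp _ _ _ (fun k => lam * ph lam D k) (psi D) _ (nbhs (lam * l))).
    by apply: cvgMl_tmp.
  exact: continuous_psi.
have -> : (fun k => psi D (lam * ph lam D k)) = [sequence ph lam D k.+1]_k.
  by apply/funext => k /=; rewrite -phS.
rewrite cvg_shiftS => /cvg_lim -/(_ (@Rhausdorff R)) lE.
apply/eqP; apply: contraT => ln0.
have l_gt0 : 0 < l by rewrite lt0r ln0 lge0.
by have := psi_lt_id l_gt0; rewrite -lE ltxx.
Qed.

(** The rescaled sequence u_k = C p_(h0 + k) satisfies u_(k+1) <= u_k^D, because C lam^D <= C^2 <=
    C^D; h0 is a depth at which u_0 <= 1/e. *)
Lemma ph_doubly_exp : (1 < D)%N ->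
  exists h0, forall k, ph lam D (h0 + k) <= expR (- (D ^ k)%:R).
Proof.
move=> D1; pose C := 1 + lam ^+ D.
have C1 : 1 <= C by rewrite lerDl exprn_ge0// ltW.
have C0 : 0 < C by rewrite (lt_le_trans ltr01).
have : \forall k \near \oo, ph lam D k < expR (-1) / C.
  apply: (@cvgr_lt R nat \oo _ (ph lam D) 0 cvg_ph).
  by rewrite divr_gt0 ?expR_gt0.
case=> h0 _ Hh0; exists h0.
suff H k : C * ph lam D (h0 + k) <= expR (- (D ^ k)%:R).
  by move=> k; rewrite (le_trans _ (H k))// ler_peMl// ltW// ph_gt0.
elim: k => [|k IH].
  by rewrite addn0 expn0 mulrC -ler_pdivlMr// ltW//; apply: Hh0 => /=.
rewrite addnS phS expnSr natrM -mulNr expRM_natr.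
apply: (@le_trans _ _ ((C * ph lam D (h0 + k)) ^+ D)); last first.
  by rewrite lerXn2r// nnegrE ?expR_ge0// mulr_ge0 ?ltW// ph_gt0.
have p0 := ltW (ph_gt0 (h0 + k)).
apply: (@le_trans _ _ (C * (lam * ph lam D (h0 + k)) ^+ D)).
  by rewrite ler_pM2l// psi_le_expr// mulr_ge0// ltW.
rewrite !exprMn mulrA ler_wpM2r ?exprn_ge0//.
apply: (@le_trans _ _ (C ^+ 2)); last by rewrite ler_weXn2l.
by rewrite expr2 ler_pM2l// lerDr.
Qed.

End Subcritical.

(** * Growth of the tree size compared with ln n *)

Section TreeGrowth.
Variable R : realType.

Lemma ln_nat_ge (M : R) : exists N, forall n, (N <= n)%N -> M <= ln (n%:R : R).
Proof.
exists (Num.bound (expR M)) => n Nn.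
have eMn : expR M < n%:R.
  apply: (@lt_le_trans _ _ (Num.bound (expR M))%:R); last by rewrite ler_nat.
  by rewrite archi_boundP// expR_ge0.
have n0 : 0 < n%:R :> R := lt_trans (expR_gt0 M) eMn.
by rewrite -(expRK M) ler_ln ?posrE ?expR_gt0// ltW.
Qed.

Lemma ln_nat_div_lt (c : R) : 0 < c ->
  exists N, forall n, (N <= n)%N -> ln (n%:R : R) / n%:R < c.
Proof.
(* With x = ln n one has n = e^x >= 1 + x^2 / 2, so x / n < c once x > 2 / c. *)
move=> c0; have [N HN] := ln_nat_ge (1 + 2 / c); exists N => n /HN.
set x := ln _ => xge.
have c2 : 0 < 2 / c by rewrite divr_gt0.
have x0 : 0 < x by lra.
have n0 : 0 < n%:R :> R.
  rewrite ltNge; apply/negP => n_le0.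
  by move: x0; rewrite /x ln0// ltxx.
have nE : expR x = n%:R by rewrite /x lnK.
have := expR_ge1Dxn 1 (ltW x0); rewrite nE => le_n.
rewrite ltr_pdivrMr//.
have x2 : 2 / c < x by lra.
rewrite ltr_pdivrMr// in x2.
have : x * 2 < c * x ^+ 2 by rewrite expr2 mulrC mulrA (mulrC c) ltr_pM2r.
move: le_n; rewrite (_ : 2`!%:R = 2 :> R)// => le_n H.
by rewrite (lt_le_trans _ (ler_wpM2l (ltW c0) le_n))//; nra.
Qed.

Lemma tree_size_le D h : (1 < D)%N -> (tree_size D h <= D * D ^ h)%N.
Proof.
by move=> D1; rewrite /tree_size (leq_trans (leq_div _ _))// expnS leq_subr.
Qed.

Variables (D : nat) (lam : R).
Hypotheses (D_gt1 : (1 < D)%N) (lam_gt0 : 0 < lam) (lam_lt : lam < lambda_D R D).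

Let D_gt0 : 0 < D%:R :> R. Proof. by rewrite ltr0n ltnW. Qed.
Let lnD_gt0 : 0 < ln (D%:R : R). Proof. by rewrite ln_gt0// ltr1n. Qed.

(** Take A = D^h0. For k >= h0 the decay gives 1 / n <= ln n / n < exp (- D^(k - h0)), hence D^(k -
    h0) < ln n; smaller k are covered by ln n >= 1. *)
Lemma pattern_depth_bound : exists2 A : R, 0 < A & forall n k,
  1 <= ln (n%:R : R) -> ln (n%:R : R) / n%:R < ph lam D k -> (D ^ k)%:R <= A * ln (n%:R : R).
Proof.
have [h0 Hh0] : exists h0, forall k, ph lam D (h0 + k) <= expR (- (D ^ k)%:R).
  by case: D D_gt1 lam_lt => // D' D1 lt; exact: ph_doubly_exp.
exists (D ^ h0)%:R => [|n k ln1 ltp]; first by rewrite ltr0n expn_gt0 ltnW.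
have n0 : 0 < n%:R :> R.
  rewrite ltNge; apply/negP => n_le0.
  by move: ln1; rewrite ln0// ler10.
have [kh|hk] := ltnP k h0.
  by rewrite (@le_trans _ _ (D ^ h0)%:R) ?ler_peMr// ler_nat leq_pexp2l ?(ltnW D_gt1)// ltnW.
move: ltp; rewrite -(subnKC hk); set j := (k - h0)%N => ltp.
rewrite expnD natrM ler_pM2l ?ltr0n ?expn_gt0 ?(ltnW D_gt1)//.
have : (n%:R : R)^-1 < expR (- (D ^ j)%:R).
  apply: lt_le_trans (Hh0 j); apply: le_lt_trans ltp.
  by rewrite ler_peMl// invr_ge0 ltW.
rewrite expRN ltf_pV2 ?posrE ?expR_gt0// => lt_n.
by rewrite -[leLHS]expRK ler_ln ?posrE ?expR_gt0// ltW.
Qed.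

(** A is independent of m. Depth m qualifies for large n since p_m > 0 while ln n / n tends to 0;
    the upper bound holds for every qualifying depth, hence for the supremum. *)
Lemma underline_h_bound : exists2 A : R, 0 < A & forall m, (0 < m)%N ->
  exists N, forall n, (N <= n)%N -> m%:R <= underline_h lam D n /\
    underline_h lam D n * ln (D%:R : R) <= ln (A * ln (n%:R : R)).
Proof.
have [A A0 HA] := pattern_depth_bound; exists A => // m m0.
have pm : 0 < ph lam D m by case: D D_gt1 lam_lt => // D' D1 lt; exact: ph_gt0.
have [N1 HN1] := ln_nat_div_lt pm; have [N2 HN2] := ln_nat_ge 1.
exists (maxn N1 N2) => n; rewrite geq_max => /andP[/HN1 nm /HN2 ln1].
set S := [set x : R | exists h : nat, (0 < h)%N /\ x = h%:R /\ ln (n%:R) / n%:R < ph lam D h].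
have Sm : S m%:R by exists m.
have ubS : ubound S (ln (A * ln (n%:R : R)) / ln (D%:R : R)).
  move=> _ [k [_ [-> /(HA _ _ ln1) le_k]]].
  rewrite ler_pdivlMr// mulr_natl -lnXn// -natrX ler_ln ?posrE//.
    by rewrite ltr0n expn_gt0 ltnW.
  by rewrite mulr_gt0// (lt_le_trans ltr01).
have supS : has_sup S by split; [exists m%:R|eexists; exact: ubS].
split; first exact: sup_upper_bound.
by rewrite -ler_pdivlMr//; apply: ge_sup => //; exists m%:R.
Qed.

(** Exponentiating the hypothesis gives D^h <= D^H / H <= A ln n / m with H = [underline_h], where m
    is as large as desired. *)
Lemma tree_size_small (h : nat -> nat) (e : R) : 0 < e ->
  (exists N : nat, forall n : nat, (N <= n)%N ->
     (h n)%:R <= underline_h lam D n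
                 - ln (underline_h lam D n) / ln (D%:R : R)
                 + ln (1 - (D%:R : R)^-1) / ln (D%:R : R)) ->
  exists N, forall n, (N <= n)%N -> (tree_size D (h n))%:R <= e * ln (n%:R : R).
Proof.
move=> e0 [N0 HN0]; have [A A0 HA] := underline_h_bound.
(* Chosen so that D A / m <= e. *)
pose m := (Num.bound (D%:R * A / e)).+1.
have [N1 HN1] := HA m isT; have [N2 HN2] := ln_nat_ge 1.
exists (maxn N0 (maxn N1 N2)) => n; rewrite !geq_max => /and3P[/HN0 hn /HN1[mH HB] /HN2 ln1].
set H := underline_h lam D n in hn mH HB.
have m0 : 0 < m%:R :> R by rewrite ltr0n.
have L0 : 0 < ln (n%:R : R) by rewrite (lt_le_trans ltr01).
have H0 : 0 < H := lt_le_trans m0 mH.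
have Dh : (D ^ h n)%:R <= A * ln (n%:R : R) / m%:R.
  rewrite -ler_ln ?posrE ?ltr0n ?expn_gt0 ?(ltnW D_gt1)// ?divr_gt0 ?mulr_gt0//.
  rewrite natrX lnXn// -[leLHS]mulr_natl ln_div ?posrE ?mulr_gt0//.
  have lnD0 := lt0r_neq0 lnD_gt0.
  have := ler_wpM2r (ltW lnD_gt0) hn.
  rewrite mulrDl mulrBl !divfK//.
  have : ln (1 - (D%:R : R)^-1) <= 0 by rewrite ln_le0// gerBl invr_ge0 ltW.
  have : ln (m%:R : R) <= ln H by rewrite ler_ln ?posrE.
  lra.
apply: (@le_trans _ _ (D%:R * (D ^ h n)%:R)).
  by rewrite -natrM ler_nat tree_size_le.
apply: (@le_trans _ _ (D%:R * (A * ln (n%:R : R) / m%:R))); first by rewrite ler_pM2l.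
rewrite !mulrA -(mulrAC _ m%:R^-1) ler_pM2r// ler_pdivrMr// (mulrC e) -ler_pdivrMr//.
rewrite ltW// (@lt_trans _ _ (Num.bound (D%:R * A / e))%:R)// ?ltr_nat//.
by rewrite archi_boundP// divr_ge0 ?mulr_ge0// ltW.
Qed.

End TreeGrowth.

(** * Second moment of the likelihood ratio *)

Section SecondMoment.
Variable R : realType.

(** Expand the product of x + y over A and of 0 + 1 off A; a subset not inside A picks up a factor
    0. *)
Lemma sum_subset_expr (T : finType) (A : {set T}) (x y : R) :
  \sum_(B : {set T} | B \subset A) x ^+ #|B| * y ^+ (#|A| - #|B|) = (x + y) ^+ #|A|.
Proof.
transitivity (\prod_(i : T) ((if i \in A then x else 0) + (if i \in A then y else 1))); last
  first.
  rewrite -prodr_const [RHS]big_mkcond /=.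
  by apply: eq_bigr => i _; case: ifP; rewrite // add0r.
rewrite bigA_distr big_mkcond /=; apply: eq_bigr => B _.
case: ifPn => [BA|/subsetPn[i iB iA]]; last first.
  by rewrite (bigD1 i)//= iB (negbTE iA) mul0r.
rewrite (bigID (mem B))/=; congr (_ * _).
  by rewrite -prodr_const; apply: eq_bigr => i iB; rewrite iB (fintype.subsetP BA).
have -> : (#|A| - #|B|)%N = #|A :\: B| by rewrite cardsD (finset.setIidPr BA).
rewrite (eq_bigr (fun i => if i \in A then y else 1)) => [|i /negbTE ->//].
by rewrite -big_mkcondr -prodr_const; apply: eq_bigl => i; rewrite !inE.
Qed.

Variables (n : nat) (p : R).
Hypotheses (p_gt0 : 0 < p) (p_le1 : p <= 1).
Implicit Types (A G : graph n).

Lemma P0_ge0 G : 0 <= P0 p G.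
Proof.
by rewrite /P0; case: ifP => // _; rewrite mulr_ge0// exprn_ge0// ?subr_ge0// ltW.
Qed.

Lemma sum_P0 : \sum_(G : graph n) P0 p G = 1.
Proof.
by rewrite /P0 -big_mkcond/= sum_subset_expr (addrC p) subrK expr1n.
Qed.

(** This is the density with respect to [P0] of the law of G0 with A planted. The solutions G0 are
    (G minus A) joined with some B inside A, and the weights of B sum to (p + (1 - p))^|A| = 1. *)
Lemma P0_union A G : A \subset slots n ->
  \sum_(G0 : graph n) P0 p G0 * (G == G0 :|: A)%:R = (A \subset G)%:R / p ^+ #|A| * P0 p G.
Proof.
move=> AS; have [AG|nAG] := boolP (A \subset G); last first.
  rewrite !mul0r big1// => G0 _; case: eqP => [GE|_]; last by rewrite mulr0.
  by rewrite GE finset.subsetUr in nAG.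
have [GS|nGS] := boolP (G \subset slots n); last first.
  rewrite {2}/P0 (negbTE nGS) mulr0 big1// => G0 _; case: eqP => [GE|_]; last by rewrite mulr0.
  by rewrite /P0 ifN ?mul0r//; apply: contra nGS; rewrite GE finset.subUset AS andbT.
rewrite (eq_bigr (fun G0 => if G == G0 :|: A then P0 p G0 else 0)); last first.
  by move=> G0 _; case: eqP; rewrite ?mulr1 ?mulr0.
rewrite -big_mkcond /=.
rewrite (reindex_onto (fun B : graph n => (G :\: A) :|: B) (fun G0 => G0 :&: A)); last first.
  move=> G0 /eqP ->; apply/finset.setP => e; rewrite !inE.
  by case: (e \in G0); case: (e \in A).
rewrite (eq_bigl (fun B : graph n => B \subset A)); last first.
  move=> B; apply/andP/idP => [[_ /eqP <-]|BA]; first exact: finset.subsetIr.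
  split; apply/eqP/finset.setP => e; rewrite !inE.
    have /implyP := fintype.subsetP BA e; have /implyP := fintype.subsetP AG e.
    by case: (e \in G); case: (e \in A); case: (e \in B).
  have /implyP := fintype.subsetP BA e.
  by case: (e \in G); case: (e \in A); case: (e \in B).
have cAG := subset_leq_card AG; have cGS := subset_leq_card GS.
transitivity (p ^+ (#|G| - #|A|) * (1 - p) ^+ (#|slots n| - #|G|) *
    \sum_(B : graph n | B \subset A) p ^+ #|B| * (1 - p) ^+ (#|A| - #|B|)).
  rewrite mulr_sumr; apply: eq_bigr => B BA.
  have cBA := subset_leq_card BA.
  have cU : #|(G :\: A) :|: B| = (#|G| - #|A| + #|B|)%N.
    rewrite finset.cardsU cardsD (finset.setIidPr AG) (_ : (G :\: A) :&: B = finset.set0)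
      ?cards0 ?subn0//.
    apply/finset.setP => e; rewrite !inE; have /implyP := fintype.subsetP BA e.
    by case: (e \in G); case: (e \in A); case: (e \in B).
  rewrite /P0 ifT; last first.
    rewrite finset.subUset (fintype.subset_trans (finset.subsetDl _ _) GS)/=.
    exact: fintype.subset_trans BA AS.
  rewrite cU (_ : (#|slots n| - _)%N = (#|slots n| - #|G| + (#|A| - #|B|))%N); last by lia.
  by rewrite !exprD mulrACA.
rewrite sum_subset_expr (addrC p) subrK expr1n mulr1 mul1r /P0 GS mulrA; congr (_ * _).
by rewrite exprB ?unitfE ?lt0r_neq0// mulrC.
Qed.

(** Divided by p^|A|, the left side is the total mass of the law of G0 with A planted. *)
Lemma sum_P0_super A : A \subset slots n ->
  \sum_(G : graph n) (A \subset G)%:R * P0 p G = p ^+ #|A|.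
Proof.
move=> AS; have pA : p ^+ #|A| != 0 by rewrite expf_neq0// lt0r_neq0.
apply: (mulIf (invr_neq0 pA)); rewrite divff// mulr_suml.
transitivity (\sum_(G : graph n) \sum_(G0 : graph n) P0 p G0 * (G == G0 :|: A)%:R).
  by apply: eq_bigr => G _; rewrite P0_union// mulrAC.
rewrite exchange_big /= -[RHS]sum_P0; apply: eq_bigr => G0 _.
by rewrite -mulr_sumr (bigD1 (G0 :|: A))//= eqxx big1 ?addr0 ?mulr1// => G /negbTE ->.
Qed.

Variables (I : finType) (S : {set I}) (E : I -> graph n).
Hypotheses (S_neq0 : (0 < #|S|)%N) (E_slots : forall i, i \in S -> E i \subset slots n).

Let N : R := #|S|%:R.
Let N_gt0 : 0 < N. Proof. by rewrite ltr0n. Qed.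

(** The likelihood ratio when the planted graph is drawn uniformly from an arbitrary finite
    family. *)
Definition likelihood (G : graph n) : R :=
  N^-1 * \sum_(i in S) (E i \subset G)%:R / p ^+ #|E i|.

Lemma sum_likelihood : \sum_(G : graph n) likelihood G * P0 p G = 1.
Proof.
transitivity (N^-1 * \sum_(i in S) \sum_(G : graph n) ((E i \subset G)%:R * P0 p G) / p ^+
  #|E i|).
  rewrite exchange_big /= mulr_sumr; apply: eq_bigr => G _.
  by rewrite -mulrA mulr_suml; congr (_ * _); apply: eq_bigr => i _; rewrite mulrAC.
rewrite (eq_bigr (fun=> 1)) => [|i iS].
  by rewrite sumr_const -[X in _ * X]/N mulVf// lt0r_neq0.
by rewrite -mulr_suml sum_P0_super ?E_slots// divff// expf_neq0// lt0r_neq0.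
Qed.

(** Two copies are both present with probability p to the size of their union, and
    inclusion-exclusion leaves only the overlap. *)
Lemma sum_likelihood2 : \sum_(G : graph n) likelihood G ^+ 2 * P0 p G =
  N^-1 * \sum_(j in S) (N^-1 * \sum_(i in S) p^-1 ^+ #|E i :&: E j|).
Proof.
transitivity (N^-1 * \sum_(j in S) (N^-1 * \sum_(i in S)
    ((\sum_(G : graph n) (E i :|: E j \subset G)%:R * P0 p G) / (p ^+ #|E i| * p ^+ #|E j|)))).
  rewrite -mulr_sumr exchange_big mulrA mulr_sumr.
  under [RHS]eq_bigr do rewrite mulr_sumr.
  under [RHS]eq_bigr do under eq_bigr do rewrite mulr_suml mulr_sumr.
  under [RHS]eq_bigr do rewrite exchange_big.
  rewrite [RHS]exchange_big; apply: eq_bigr => G _ /=.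
  rewrite /likelihood expr2 mulrACA mulr_suml mulr_sumr mulr_suml; apply: eq_bigr => i _.
  rewrite mulr_sumr mulr_sumr mulr_suml; apply: eq_bigr => j _.
  rewrite finset.subUset -mulnb natrM invfM; ring.
congr (_ * _); apply: eq_bigr => j jS; congr (_ * _); apply: eq_bigr => i iS.
rewrite sum_P0_super ?finset.subUset ?E_slots// -exprD -cardsUI exprD.
by rewrite exprVn invfM mulrA divff ?mul1r// expf_neq0// lt0r_neq0.
Qed.

(* |x| <= e + x^2 / e in place of the Cauchy-Schwarz inequality. *)
Lemma chi_square_bound (e d : R) : 0 < e ->
  (forall j, j \in S -> N^-1 * \sum_(i in S) p^-1 ^+ #|E i :&: E j| <= 1 + d) ->
  \sum_(G : graph n) `|likelihood G * P0 p G - P0 p G| <= e + d / e.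
Proof.
move=> e0 Hd.
have L2 : \sum_(G : graph n) likelihood G ^+ 2 * P0 p G <= 1 + d.
  rewrite sum_likelihood2 mulrC ler_pdivrMr//.
  by rewrite (le_trans (ler_sum _ Hd))// sumr_const -mulr_natr.
apply: (@le_trans _ _ (\sum_(G : graph n)
    (e * P0 p G + e^-1 * (likelihood G ^+ 2 * P0 p G - 2 * (likelihood G * P0 p G) + P0 p G)))).
  apply: ler_sum => G _; have P0G := P0_ge0 G.
  rewrite -[X in _ - X]mul1r -mulrBl normrM (ger0_norm P0G).
  rewrite (_ : e * _ + _ = (e + e^-1 * (likelihood G - 1) ^+ 2) * P0 p G); last by ring.
  rewrite ler_wpM2r//; set x := likelihood G - 1.
  rewrite -(ler_pM2l e0) mulrDr mulrA divff ?lt0r_neq0// mul1r -(real_normK (num_real x)).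
  by have := normr_ge0 x; nra.
rewrite big_split /= -!mulr_sumr sum_P0 mulr1 lerD2l mulrC.
rewrite ler_pM2r ?invr_gt0// big_split sumrB/= -mulr_sumr sum_likelihood sum_P0; lra.
Qed.

End SecondMoment.

(** * Counting maps of sub-forests *)

Section Counting.

(* Values are chosen in increasing order of the index; [t0] fills the
   indices that have not been reached yet. *)
Lemma card_sequential (K : nat) (T : finType) (t0 : T)
    (C : 'I_K -> {ffun 'I_K -> T} -> {set T}) (b : 'I_K -> nat) :
  (forall (v : 'I_K) (f g : {ffun 'I_K -> T}), (forall u : 'I_K, (u < v)%N -> f u = g u) -> C
    v f = C v g) ->
  (forall v f, (#|C v f| <= b v)%N) ->
  (#|[set f : {ffun 'I_K -> T} | [forall v, f v \in C v f]]%SET| <= \prod_(v : 'I_K) b v)%N.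
Proof.
move=> Cloc Cb.
pose S k := [set f : {ffun 'I_K -> T} |
  [forall v : 'I_K, if (v < k)%N then f v \in C v f else f v == t0]]%SET.
suff H k : (k <= K)%N -> (#|S k| <= \prod_(v : 'I_K | (v < k)%N) b v)%N.
  have := H K (leqnn K).
  rewrite (eq_bigl xpredT) => [|v]; last by rewrite ltn_ord.
  apply: leq_trans; apply: subset_leq_card; apply/fintype.subsetP => f.
  by rewrite !inE => /forallP fC; apply/forallP => v; rewrite ltn_ord fC.
elim: k => [_|k IH kK].
  rewrite big_pred0//; apply: (@leq_trans #|[set [ffun=> t0] : {ffun 'I_K -> T}]%SET|); last
    by rewrite cards1.
  apply/subset_leq_card/fintype.subsetP => f; rewrite !inE => /forallP ft.
  by apply/eqP/ffunP => v; rewrite ffunE; apply/eqP; exact: ft v.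
pose v0 := Ordinal kK.
(* [rst] forgets the value chosen last and sends S k.+1 into S k. *)
pose rst (f : {ffun 'I_K -> T}) : {ffun 'I_K -> T} := [ffun v => if v == v0 then t0 else f v].
have rstE f (u : 'I_K) : (u < k)%N -> rst f u = f u.
  by move=> uk; rewrite ffunE; case: eqP => // uE; rewrite uE ltnn in uk.
have rstS f : f \in S k.+1 -> rst f \in S k.
  rewrite !inE => /forallP fS; apply/forallP => v; have := fS v.
  case: (ltnP v k) => vk.
    rewrite ltnW// rstE// (Cloc v f (rst f))// => u uv.
    by rewrite rstE// (ltn_trans uv).
  rewrite ffunE; case: (v =P v0) => // vv0.
  have kv : (k < v)%N.
    by rewrite ltn_neqAle vk andbT; apply/eqP => kE; apply: vv0; apply/val_inj.
  by rewrite ltnS leqNgt kv.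
rewrite (bigD1 v0)//= (eq_bigl (fun v : 'I_K => (v < k)%N)); last first.
  move=> v; rewrite ltnS leq_eqVlt; case: (eqVneq v v0) => [->|vv0] /=; first by rewrite
    andbF ltnn.
  by rewrite andbT; case: eqP => // vk; case/eqP: vv0; apply/val_inj.
rewrite mulnC; apply: leq_trans (leq_mul (IH (ltnW kK)) (leqnn (b v0))).
rewrite -sum_nat_const -[leqLHS]sum1_card (partition_big rst (mem (S k)))//=.
apply: leq_sum => g gS; rewrite sum1dep_card -[X in (_ <= X)%N]/(b v0).
apply: leq_trans (Cb v0 g).
(* Maps in one fibre of [rst] agree off v0, so evaluation at v0 embeds the fibre in C v0 g. *)
rewrite -(card_in_imset (f := fun f : {ffun 'I_K -> T} => f v0)); last first.
  move=> f1 f2; rewrite !inE => /andP[_ /eqP f1g] /andP[_ /eqP f2g] e12.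
  apply/ffunP => v; have [->//|vv0] := eqVneq v v0.
  by have /ffunP/(_ v) := etrans f1g (esym f2g); rewrite !ffunE (negbTE vv0).
apply/subset_leq_card/fintype.subsetP => _ /imsetP[f + ->].
rewrite !inE => /andP[/forallP/(_ v0) + /eqP <-]; rewrite /= ltnSn.
by rewrite (Cloc v0 f (rst f))// => u uk; rewrite rstE.
Qed.

Variables (K : nat) (T : finType) (par : 'I_K -> 'I_K) (adj : rel T) (V : {set T}) (d : nat).
Hypotheses (par_lt : forall v : 'I_K, (0 < v)%N -> (par v < v)%N)
  (adj_deg : forall x, (#|[set y | adj x y]%SET| <= d)%N)
  (adj_V : forall x y, adj x y -> x \in V).

(** A set F of indices encodes a sub-forest: v in F stands for the edge from par v to v. A vertex
    outside F with a child in F is the root of a nontrivial component. *)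
Definition has_child_in (F : {set 'I_K}) (v : 'I_K) := [exists w in F, par w == v].

(** A vertex of F goes to one of at most d neighbours of its parent's image; the root of a
    nontrivial component lands in V because its image has a neighbour. *)
Lemma card_forest_maps (t0 : T) (F : {set 'I_K}) : {in F, forall v : 'I_K, (0 < v)%N} ->
  (#|[set f : {ffun 'I_K -> T} | [forall v in F, adj (f (par v)) (f v)]]%SET| <=
   \prod_(v : 'I_K) (if v \in F then d else if has_child_in F v then #|V| else #|T|))%N.
Proof.
move=> F0.
pose C (v : 'I_K) (f : {ffun 'I_K -> T}) : {set T} :=
  if v \in F then [set y | adj (f (par v)) y]%SET
  else if has_child_in F v then V else [set: T]%SET.
have := @card_sequential K T t0 C
  (fun v => if v \in F then d else if has_child_in F v then #|V| else #|T|).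
move=> H; apply: leq_trans (H _ _).
- apply/subset_leq_card/fintype.subsetP => f; rewrite !inE => /forall_inP fF.
  apply/forallP => v; rewrite /C; case: ifPn => vF; first by rewrite inE fF.
  by case: ifPn => [/exists_inP[w wF /eqP <-]|_]; [exact: adj_V (fF w wF)|rewrite inE].
- move=> v f g fg; rewrite /C; case: ifPn => // vF.
  by apply/finset.setP => y; rewrite !inE fg// par_lt// F0.
- by move=> v f; rewrite /C; case: ifPn => // _; case: ifPn => // _; rewrite cardsT.
Qed.

(** The parent of the least index in F is smaller still, hence outside F. *)
Lemma exists_root (F : {set 'I_K}) : {in F, forall v : 'I_K, (0 < v)%N} ->
  F != finset.set0 -> exists2 v, v \notin F & has_child_in F v.
Proof.
move=> F0 /set0Pn[v vF].
have [m mF mmin] := @arg_minnP _ v (mem F) val vF.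
exists (par m); last by apply/exists_inP; exists m.
by apply/negP => /mmin; rewrite leqNgt par_lt// F0.
Qed.

Variable R : realType.

Lemma prod_expand (w : R) (f : {ffun 'I_K -> T}) :
  \prod_(v : 'I_K | (0 < v)%N) (1 + w * (adj (f (par v)) (f v))%:R) =
  \sum_(F : {set 'I_K}) [forall v in F, (0 < v)%N]%:R * (w ^+ #|F| *
     [forall v in F, adj (f (par v)) (f v)]%:R).
Proof.
rewrite big_mkcond /=.
rewrite (eq_bigr (fun v : 'I_K => (if (0 < v)%N then w * (adj (f (par v)) (f v))%:R else 0) +
  1)); last first.
  by move=> v _; case: ifP => _; rewrite ?add0r// addrC.
rewrite bigA_distr; apply: eq_bigr => F _; rewrite -big_mkcond /=.
have [/forall_inP F0|/forall_inPn[v vF v0]] := boolP [forall v in F, (0 < v)%N]; last first.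
  by rewrite mul0r (bigD1 v)//= (negbTE v0) mul0r.
rewrite mul1r (eq_bigr (fun v : 'I_K => w * (adj (f (par v)) (f v))%:R)) => [|v vF]; last by
  rewrite F0.
rewrite big_split /= prodr_const; congr (_ * _).
have [/forall_inP Fa|/forall_inPn[v vF va]] := boolP [forall v in F, adj (f (par v)) (f v)].
  by rewrite big1// => v vF; rewrite Fa.
by rewrite (bigD1 v)//= (negbTE va) mul0r.
Qed.

(** The empty F gives at most |S|. Any other F has a component root with factor at most K, the K - 1
    remaining factors being at most C |T|; there are at most 2^K such F. *)
Lemma sum_injections_prod (w C : R) (S : {set {ffun 'I_K -> T}}) (t0 : T) :
  0 <= w -> 1 <= C -> w * d%:R <= C * #|T|%:R -> (#|V| <= K)%N -> (K <= #|T|)%N ->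
  \sum_(f in S) \prod_(v : 'I_K | (0 < v)%N) (1 + w * (adj (f (par v)) (f v))%:R) <=
  #|S|%:R + 2 ^+ K * (K%:R * (C * #|T|%:R) ^+ K.-1).
Proof.
move=> w0 C1 wd VK KT; have C0 : 0 <= C := le_trans ler01 C1.
have T0 : 0 < #|T|%:R :> R by rewrite ltr0n; apply/card_gt0P; exists t0.
under eq_bigr do rewrite prod_expand.
rewrite exchange_big (bigD1 finset.set0)//= lerD//.
  rewrite -sumr_const ler_sum// => f _.
  by rewrite cards0 expr0 mul1r mulr_ile1 ?ler0n// lern1 leq_b1.
set X := K%:R * _.
apply: (@le_trans _ _ (\sum_(F : {set 'I_K}) X)); last first.
  by rewrite sumr_const -cardsT -finset.powersetT card_powerset cardsT card_ord
    -[leLHS]mulr_natl natrX.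
have X0 : 0 <= X by rewrite mulr_ge0 ?exprn_ge0// mulr_ge0// ltW.
rewrite [leRHS](bigD1 finset.set0)//= ler_wpDl//; apply: ler_sum => F Fn0.
rewrite -!mulr_sumr.
have [/forall_inP F0|_] := boolP [forall v in F, (0 < v)%N]; last by rewrite mul0r.
rewrite mul1r.
pose HF := [set f : {ffun 'I_K -> T} | [forall v in F, adj (f (par v)) (f v)]]%SET.
apply: (@le_trans _ _ (w ^+ #|F| * #|HF|%:R)).
  rewrite ler_wpM2l ?exprn_ge0// -natr_sum ler_nat -sum1_card [leqRHS]big_mkcond /=
    [leqLHS]big_mkcond /=.
  by apply: leq_sum => f _; rewrite inE; case: (f \in S) => //; case: ifP.
have := card_forest_maps t0 F0; rewrite -/HF -(ler_nat R) natr_prod => cHF.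
apply: le_trans (ler_wpM2l (exprn_ge0 _ w0) cHF) _.
rewrite -prodr_const big_mkcond /= -big_split /=.
have [v0 v0F v0c] := exists_root F0 Fn0.
rewrite (bigD1 v0)//= (negbTE v0F) v0c mul1r /X.
have K1 : K.-1 = #|[pred v : 'I_K | v != v0]|.
  by have := cardC1 v0; rewrite card_ord => <-; apply: eq_card.
rewrite K1 -prodr_const ler_pM ?ler_nat//.
  by apply: prodr_ge0 => v _; rewrite mulr_ge0//; case: ifP.
apply: ler_prod => v _; apply/andP; split; first by rewrite mulr_ge0//; case: ifP.
(* A vertex of F contributes w d, another component root |V| <= K <= |T|, any other vertex |T|. *)
case: ifP => // _; rewrite mul1r; case: ifP => _; last by rewrite ler_peMl// ltW.
by rewrite (@le_trans _ _ #|T|%:R) ?ler_peMl ?(ltW T0)// ler_nat (leq_trans VK).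
Qed.

End Counting.

(** * Overlaps of randomly planted trees *)

Section PlantedTree.
Variables (n D h : nat).
Hypothesis D_gt1 : (1 < D)%N.
Local Notation K := (tree_size D h).
Implicit Types (v : 'I_K) (sigma tau : {ffun 'I_K -> 'I_n}) (x y : 'I_n).

Lemma tree_parent_subproof v : ((v - 1) %/ D < K)%N.
Proof. by rewrite (leq_ltn_trans (leq_div _ _))// (leq_ltn_trans (leq_subr _ _))// ltn_ord. Qed.

(** Truncated subtraction makes 0 its own parent, hence the guards 0 < v below. *)
Definition tree_parent v : 'I_K := Ordinal (tree_parent_subproof v).

Lemma tree_parent_lt v : (0 < v)%N -> (tree_parent v < v)%N.
Proof. by move=> v0; rewrite /= (leq_ltn_trans (leq_div _ _))// subn1 prednK. Qed.

Lemma nedge_inj x y a b : nedge x y = nedge a b -> (x = a /\ y = b) \/ (x = b /\ y = a).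
Proof. by rewrite /nedge; case: ifP => _; case: ifP => _ [-> ->]; auto. Qed.

Lemma plantedP sigma e :
  reflect (exists2 v : 'I_K, (0 < v)%N & e = nedge (sigma (tree_parent v)) (sigma v)) (e \in
    planted sigma).
Proof.
apply: (iffP imsetP) => [[[u v]]|[v v0 ->]].
  rewrite inE /= => /andP[v0 /eqP uE] ->; exists v => //.
  by congr (nedge (sigma _) _); apply/val_inj.
by exists (tree_parent v, v) => //; rewrite inE /= v0 eqxx.
Qed.

Lemma planted_slots sigma : injective sigma -> planted sigma \subset slots n.
Proof.
move=> inj; apply/fintype.subsetP => e /plantedP[v v0 ->]; rewrite inE /nedge.
case: ifP => //= /negbT; rewrite -leqNgt leq_eqVlt => /orP[/eqP/val_inj/inj vE|//].
by have := tree_parent_lt v0; rewrite -vE ltnn.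
Qed.

Definition planted_adj tau x y := nedge x y \in planted tau.

Lemma planted_adj_img tau x y : planted_adj tau x y -> x \in [set tau v | v in 'I_K]%SET.
Proof.
by move=> /plantedP[v v0 /nedge_inj[[-> _]|[-> _]]]; apply/imsetP; eexists.
Qed.

(** Siblings v are told apart by the residue of v - 1 modulo D. *)
Lemma card_children (u : 'I_K) : (#|[set v : 'I_K | (0 < v)%N & tree_parent v == u]%SET| <=
  D)%N.
Proof.
have D0 : (0 < D)%N by rewrite ltnW.
have := @leq_card_in _ _ (fun v : 'I_K => Ordinal (ltn_pmod (v - 1) D0))
  [set v : 'I_K | (0 < v)%N & tree_parent v == u]%SET.
rewrite card_ord; apply => v w.
rewrite !inE => /andP[v0 /eqP vu] /andP[w0 /eqP wu] [mE].
apply/val_inj => /=; have : tree_parent v = tree_parent w by rewrite vu.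
move=> /(congr1 val) /= dE.
have : (v - 1 = w - 1)%N by rewrite (divn_eq (v - 1) D) (divn_eq (w - 1) D) dE mE.
lia.
Qed.

(** The neighbours of tau u lie among the images of the parent and of the at most D children of
    u. *)
Lemma planted_deg tau x : injective tau -> (#|[set y | planted_adj tau x y]%SET| <= D.+1)%N.
Proof.
move=> inj; have [/imsetP[u _ ->]|xN] := boolP (x \in [set tau v | v in 'I_K]%SET); last first.
  rewrite (_ : [set y | _]%SET = finset.set0) ?cards0//; apply/finset.setP => y; rewrite !inE.
  by apply/negP => /planted_adj_img; exact/negP.
pose ch := [set v : 'I_K | (0 < v)%N & tree_parent v == u]%SET.
apply: (@leq_trans #|tau (tree_parent u) |: [set tau v | v in ch]%SET|).
  apply/subset_leq_card/fintype.subsetP => y; rewrite !inE => /plantedP[v v0].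
  move=> /nedge_inj[[/inj uE ->]|[/inj -> ->]]; last by rewrite eqxx.
  by apply/orP; right; apply/imsetP; exists v => //; rewrite inE v0 uE eqxx.
rewrite cardsU1 -[D.+1]add1n leq_add ?leq_b1// (leq_trans (leq_imset_card _ _))//.
exact: card_children.
Qed.

Lemma overlap_le sigma tau : (#|planted sigma :&: planted tau| <=
  #|[set v : 'I_K | (0 < v)%N & planted_adj tau (sigma (tree_parent v)) (sigma v)]%SET|)%N.
Proof.
apply: leq_trans (leq_imset_card (fun v => nedge (sigma (tree_parent v)) (sigma v)) _).
apply/subset_leq_card/fintype.subsetP => e; rewrite inE => /andP[/plantedP[v v0 ->] et].
by apply/imsetP; exists v => //; rewrite inE v0.
Qed.

(** Each factor of the falling factorial is at least m / 2. This compares the number of injections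
    with that of all maps. *)
Lemma exp_le_ffact m k : (2 * k <= m)%N -> (m ^ k <= 2 ^ k * m ^_ k)%N.
Proof.
elim: k => // k IH km; rewrite !expnSr ffactnSr mulnACA leq_mul ?IH//; lia.
Qed.

Variables (R : realType) (lam C : R).
Hypotheses (lam_gt0 : 0 < lam) (C_ge1 : 1 <= C) (degC : D.+1%:R / lam <= C).
Hypotheses (n_gt0 : (0 < n)%N) (lam_le : lam <= n%:R) (K_le : (2 * K <= n)%N).

Let p : R := lam / n%:R.
Let n0 : 0 < n%:R :> R. Proof. by rewrite ltr0n. Qed.
Let p_gt0 : 0 < p. Proof. exact: divr_gt0. Qed.
Let p_le1 : p <= 1. Proof. by rewrite ler_pdivrMr// mul1r. Qed.

Lemma card_injections : #|injections n D h| = (n ^_ K)%N.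
Proof. by rewrite /injections card_inj_ffuns !card_ord. Qed.

Lemma card_injections_gt0 : (0 < #|injections n D h|)%N.
Proof. by rewrite card_injections ffact_gt0; lia. Qed.

(** The factor 8^K collects 2^K sub-forests, K <= 2^K, and the loss 2^K from counting injections;
    the missing power of n gives 1 / n. *)
Lemma overlap_excess :
  2 ^+ K * (K%:R * (C * n%:R) ^+ K.-1) <= #|injections n D h|%:R * ((8 * C) ^+ K / n%:R).
Proof.
have C0 : 0 <= C := le_trans ler01 C_ge1.
rewrite card_injections [leRHS]mulrA ler_pdivlMr//.
have := exp_le_ffact K_le; have : (K <= 2 ^ K)%N by rewrite ltnW// ltn_expl.
(* [K.-1] is truncated at K = 0, where the left side is 0. *)
case: K => [|k]; first by rewrite !(mul0r, mulr0) mulr_ge0// exprn_ge0// mulr_ge0.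
set N := (n ^_ k.+1)%N => k2 nN.
apply: (@le_trans _ _ (2 ^+ k.+1 * 2 ^+ k.+1 * C ^+ k.+1 * (n ^ k.+1)%:R)).
  rewrite natrX (exprS n%:R) /= exprMn (mulrC n%:R) !mulrA ler_pM2r// ler_pM2r ?exprn_gt0//.
  rewrite -!mulrA ler_pM2l ?exprn_gt0// ler_pM ?exprn_ge0//.
    by rewrite -natrX ler_nat.
  by rewrite exprS ler_peMl ?exprn_ge0.
apply: (@le_trans _ _ (2 ^+ k.+1 * 2 ^+ k.+1 * C ^+ k.+1 * (2 ^ k.+1 * N)%:R)).
  by rewrite ler_wpM2l ?ler_nat// !mulr_ge0// exprn_ge0.
rewrite (_ : 8 * C = 2 * 2 * 2 * C); last by ring.
by rewrite !exprMn natrM natrX le_eqVlt; apply/orP; left; apply/eqP; ring.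
Qed.

(** With w = 1/p - 1, each tree edge sent into [planted tau] gives a factor 1 + w = 1/p, and
    [sum_injections_prod] applies since w (D + 1) <= n (D + 1) / lam <= C n. *)
Lemma overlap_second_moment tau : injective tau ->
  #|injections n D h|%:R^-1 * \sum_(sigma in injections n D h)
     p^-1 ^+ #|planted sigma :&: planted tau| <= 1 + (8 * C) ^+ K / n%:R.
Proof.
move=> inj; have N0 : 0 < #|injections n D h|%:R :> R by rewrite ltr0n card_injections_gt0.
have pV1 : 1 <= p^-1 by rewrite invf_ge1.
pose w := p^-1 - 1.
rewrite mulrC ler_pdivrMr// mulrDl mul1r [X in _ <= _ + X]mulrC.
apply: le_trans (lerD (lexx _) overlap_excess).
have := @sum_injections_prod K 'I_n tree_parent (planted_adj tau) [set tau v | v in 'I_K]%SET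
  D.+1
  tree_parent_lt (fun x => planted_deg x inj) (@planted_adj_img tau) R w C (injections n D h)
  (Ordinal n_gt0).
rewrite card_ord subr_ge0 => /(_ pV1 C_ge1) H; apply: le_trans (H _ _ _).
- apply: ler_sum => sigma _.
  rewrite (eq_bigr (fun v : 'I_K => if planted_adj tau (sigma (tree_parent v)) (sigma v) then
    p^-1 else 1)); last first.
    by move=> v _; case: ifP => _; rewrite ?mulr1 ?mulr0 ?addr0// /w addrC subrK.
  rewrite -big_mkcondr /=.
  rewrite (eq_bigl (mem [set v : 'I_K | (0 < v)%N & planted_adj tau (sigma (tree_parent v))
    (sigma v)]%SET)); last first.
    by move=> v; rewrite !inE.
  by rewrite prodr_const ler_weXn2l// overlap_le.
- apply: (@le_trans _ _ (p^-1 * D.+1%:R)); first by rewrite ler_wpM2r// gerBl.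
  by rewrite /p invf_div mulrAC -mulrA mulrC ler_pM2r.
- by rewrite (leq_trans (leq_imset_card _ _))// card_ord.
- lia.
Qed.

(** [P1] is [likelihood] times [P0], and the overlap bound is uniform in the second copy. *)
Lemma sum_P1_P0_bound (e : R) : 0 < e ->
  \sum_(G : graph n) `|P1 p D h G - P0 p G| <= e + (8 * C) ^+ K / n%:R / e.
Proof.
move=> e0.
have slotsP sigma : sigma \in injections n D h -> planted sigma \subset slots n.
  by rewrite inE => /injectiveP; exact: planted_slots.
rewrite (eq_bigr (fun G : graph n =>
    `|likelihood p (injections n D h) (@planted n D h) G * P0 p G - P0 p G|)).
  apply: chi_square_bound => //; first exact: card_injections_gt0.
  by move=> tau; rewrite inE => /injectiveP; exact: overlap_second_moment.
move=> G _; congr (`|_ - _|); rewrite /P1 /likelihood -mulrA mulr_suml; congr (_ * _).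
by apply: eq_bigr => sigma sI; rewrite P0_union// slotsP.
Qed.

End PlantedTree.

(** * Convergence of the two laws *)

Lemma sum_P1_P0_cvg (R : realType) (D : nat) (lam : R) (h : nat -> nat) (e : R) :
  (1 < D)%N -> 0 < lam -> lam < lambda_D R D ->
  (exists N : nat, forall n : nat, (N <= n)%N ->
     (h n)%:R <= underline_h lam D n
                 - ln (underline_h lam D n) / ln (D%:R : R)
                 + ln (1 - (D%:R : R)^-1) / ln (D%:R : R)) ->
  0 < e -> exists N, forall n, (N <= n)%N ->
    \sum_(G : graph n) `|P1 (lam / n%:R) D (h n) G - P0 (lam / n%:R) G| <= e.
Proof.
move=> D1 lam0 lamD hyp e0.
pose C : R := 1 + D.+1%:R / lam.
have DC : 0 <= D.+1%:R / lam by rewrite divr_ge0// ltW.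
have C1 : 1 <= C by rewrite lerDl.
have L0 : 0 <= ln (8 * C) by rewrite ln_ge0//; lra.
(* This makes K (1 + ln (8 C)) <= ln n / 2, so that (8 C)^K / n <= n^(-1/2). *)
pose eta : R := (2 * (1 + ln (8 * C)))^-1.
have eta0 : 0 < eta by rewrite invr_gt0; lra.
have e20 : 0 < e / 2 by rewrite divr_gt0.
have [N1 HN1] := tree_size_small D1 lam0 lamD eta0 hyp.
(* The three bounds ensure n > 0, lam <= n and n^(-1/2) <= (e / 2)^2. *)
have [N2 HN2] := ln_nat_ge (Num.max 1 (Num.max (ln lam) (- 2 * ln ((e / 2) ^+ 2)))).
exists (maxn N1 N2) => n; rewrite geq_max => /andP[/HN1 Kn /HN2].
set x := ln n%:R in Kn *; rewrite !ge_max => /and3P[x1 xlam xe].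
have n0 : 0 < n%:R :> R.
  rewrite ltNge; apply/negP => n_le0.
  by move: x1; rewrite /x ln0// ler10.
have nE : expR x = n%:R by rewrite /x lnK.
set K := tree_size D (h n) in Kn.
have KL : K%:R * (1 + ln (8 * C)) <= x / 2.
  have H : 0 < 1 + ln (8 * C) by lra.
  rewrite -ler_pdivlMr// (le_trans Kn)// /eta invfM mulrC -mulrA (mulrC x).
  by rewrite le_eqVlt; apply/orP; left; apply/eqP; ring.
have K0 : 0 <= K%:R :> R by [].
have K2 : (2 * K <= n)%N.
  rewrite -(ler_nat R) natrM; have := ln_sublinear n0; rewrite -/x.
  by have := mulr_ge0 K0 L0; lra.
have C8 : 0 < 8 * C by lra.
have dle : (8 * C) ^+ K / n%:R <= (e / 2) ^+ 2.
  rewrite -nE -expRN -{1}(lnK (x := 8 * C)) ?posrE// -expRM_natl -expRD.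
  rewrite -[leRHS]lnK ?posrE ?exprn_gt0// ler_expR; lra.
have lamn : lam <= n%:R by rewrite -ler_ln ?posrE.
apply: le_trans (@sum_P1_P0_bound n D (h n) D1 R lam C lam0 C1 _ _ lamn K2 (e / 2) e20) _.
- by rewrite lerDr.
- by rewrite -(ltr_nat R).
have : (8 * C) ^+ K / n%:R / (e / 2) <= e / 2 by rewrite ler_pdivrMr// -expr2.
rewrite -/K; lra.
Qed.

Theorem theorem10 (R : realType) (D : nat) (lam : R) (h : nat -> nat) :
  (1 < D)%N -> 0 < lam -> lam < lambda_D R D ->
  (exists N : nat, forall n : nat, (N <= n)%N ->
     (h n)%:R <= underline_h lam D n
                 - ln (underline_h lam D n) / ln (D%:R : R)
                 + ln (1 - (D%:R : R)^-1) / ln (D%:R : R)) ->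
  ((fun n : nat => tv n (lam / n%:R) D (h n)) @ \oo --> (0 : R)) /\
  (forall T : forall n : nat, graph n -> bool,
     (fun n : nat =>
        prob_test (@P1 R n (lam / n%:R) D (h n)) (T n)
        - prob_test (@P0 R n (lam / n%:R)) (T n)) @ \oo --> (0 : R)).
Proof.
move=> D1 lam0 lamD hyp; split=> [|T]; apply/cvgr0Pnorm_le => e e0;
  have [N HN] := sum_P1_P0_cvg D1 lam0 lamD hyp e0;
  exists N => // n /= /HN; apply: le_trans.
- rewrite /tv ger0_norm ?mulr_ge0 ?invr_ge0// ?sumr_ge0//.
  by rewrite ler_piMl ?sumr_ge0// invf_le1// ler1n.
(* A test takes values in {0, 1}, so the l1 distance bounds the difference of its probabilities. *)
- rewrite /prob_test -sumrB (le_trans (ler_norm_sum _ _ _))// ler_sum// => G _.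
  by rewrite -mulrBl normrM; case: (T n G); rewrite ?normr1 ?mulr1// normr0 mulr0.
Qed.
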